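(* Let $G$ be a group with identity $e$, let $R$ be a $G$-graded commutative ring with nonzero unity, and let $M$ be a $G$-graded unitary $R$-module. Let $r\in R_e$ and $g\in G$ be such that $rM_g\neq M_g$. If $(0:_Mr)\subseteq rM$, then $rM$ is a $g$-$\phi_1$-prime $R$-submodule of $M$ if and only if it is a $g$-prime $R$-submodule of $M$.
   Context: $G$ is a group with identity $e$. $R=\bigoplus_{h\in G}R_h$ is a $G$-graded commutative ring with nonzero unity $1$ ($R_h$ additive subgroups, $R_hR_k\subseteq R_{hk}$), and $M=\bigoplus_{h\in G}M_h$ is a $G$-graded unitary $R$-module ($M_h$ additive subgroups, $R_hM_k\subseteq M_{hk}$). An $R$-submodule $K$ of $M$ is graded if $K=\bigoplus_{h\in G}(K\cap M_h)$; write $K_h=K\cap M_h$. For $r\in R_e$ the submodule $rM$ is graded, with $(rM)_g=rM_g$. Notation: $(K:_RM)=\{a\in R: aM\subseteq K\}$; $(0:_Mr)=\{x\in M: rx=0\}$. For a graded $R$-submodule $K$ of $M$, $\phi_1(K)=(K:_RM)K$. $K-\phi_1(K)$ denotes set difference. Let $g\in G$ and let $K$ be a graded $R$-submodule of $M$ with $K_g\neq M_g$. - $K$ is a $g$-$\phi_1$-prime $R$-submodule of $M$ if whenever $a\in R_e$ and $x\in M_g$ satisfy $ax\in K-\phi_1(K)$, then $x\in K$ or $a\in(K:_RM)$. - $K$ is a $g$-prime $R$-submodule of $M$ if whenever $a\in R_e$ and $x\in M_g$ satisfy $ax\in K$, then $x\in K$ or $a\in(K:_RM)$. *)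

(* Defs.v *)
From HB Require Import structures.
From mathcomp Require Import all_boot all_order all_algebra.
From mathcomp Require Import all_classical.

Set Implicit Arguments.
Unset Strict Implicit.
Unset Printing Implicit Defensive.

Import GRing.Theory.
Local Open Scope classical_set_scope.
Local Open Scope ring_scope.

(* A is the internal direct sum of the additive subgroups S h. Since G may be
   infinite, sums range over duplicate-free finite sequences of indices. *)
Definition internal_direct_sum (G : choiceType) (V : zmodType)
    (A : set V) (S : G -> set V) : Prop :=
  [/\ forall h, zmod_closed [in S h],
      A = [set x | exists (s : seq G) (f : G -> V),
             [/\ uniq s, forall h, S h (f h) & x = \sum_(h <- s) f h]]
    & forall (s : seq G) (f : G -> V), uniq s -> (forall h, S h (f h)) ->
        \sum_(h <- s) f h = 0 -> {in s, forall h, f h = 0}].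

Definition ring_grading (G : groupType) (R : comNzRingType)
    (Rg : G -> set R) : Prop :=
  internal_direct_sum [set: R] Rg /\
  forall h k a b, Rg h a -> Rg k b -> Rg (h * k)%g (a * b).

Definition module_grading (G : groupType) (R : comNzRingType)
    (Rg : G -> set R) (M : lmodType R) (Mg : G -> set M) : Prop :=
  internal_direct_sum [set: M] Mg /\
  forall h k a x, Rg h a -> Mg k x -> Mg (h * k)%g (a *: x).

Definition graded_submodule (G : groupType) (R : comNzRingType)
    (M : lmodType R) (Mg : G -> set M) (K : set M) : Prop :=
  submod_closed [in K] /\ internal_direct_sum K (fun h => K `&` Mg h).

Definition residual (R : comNzRingType) (M : lmodType R) (K : set M) : set R :=
  [set a | forall x : M, K (a *: x)].

Definition annihilated (R : comNzRingType) (M : lmodType R) (r : R) : set M :=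
  [set x | r *: x = 0].
Arguments annihilated {R} M r.

Definition scale_set (R : comNzRingType) (M : lmodType R) (r : R)
    (A : set M) : set M :=
  [set r *: x | x in A].

Definition ideal_mul (R : comNzRingType) (M : lmodType R)
    (I : set R) (K : set M) : set M :=
  [set x | exists (n : nat) (a : 'I_n -> R) (y : 'I_n -> M),
     [/\ forall i, I (a i), forall i, K (y i) & x = \sum_(i < n) a i *: y i]].

Definition phi1 (R : comNzRingType) (M : lmodType R) (K : set M) : set M :=
  ideal_mul (residual K) K.

Definition g_phi1_prime (G : groupType) (R : comNzRingType) (Rg : G -> set R)
    (M : lmodType R) (Mg : G -> set M) (g : G) (K : set M) : Prop :=
  [/\ graded_submodule Mg K, K `&` Mg g <> Mg g &
      forall a x, Rg 1%g a -> Mg g x -> (K `\` phi1 K) (a *: x) ->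
        K x \/ residual K a].

Definition g_prime (G : groupType) (R : comNzRingType) (Rg : G -> set R)
    (M : lmodType R) (Mg : G -> set M) (g : G) (K : set M) : Prop :=
  [/\ graded_submodule Mg K, K `&` Mg g <> Mg g &
      forall a x, Rg 1%g a -> Mg g x -> K (a *: x) -> K x \/ residual K a].

(* Main.v *)
Require Import Defs.
From mathcomp Require Import all_boot all_order all_algebra.
From mathcomp Require Import all_classical.

Import GRing.Theory.
Local Open Scope classical_set_scope.
Local Open Scope ring_scope.

(** Write [K = rM]. Only a product [a x] lying in [phi1 K] can separate the two
    notions. For such a product the idea is to test [a + r] instead of [a]:
    since [rM] is contained in [K], this alters neither whether the product
    with [x] lies in [K] nor whether the scalar lies in [(K : M)]. If
    [(a + r) x] is outside [phi1 K], the weaker primeness applies to it.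
    Otherwise both [a x] and [(a + r) x] lie in [(K : M) K = r ((K : M) M)],
    hence in [r K] (lemma [phi1_scale_set]); subtracting, [r x = r y] for some
    [y] in [K], so [x - y] is killed by [r], and the hypothesis on [(0 : r)]
    puts [x] back in [K]. *)

Lemma scale_setTB (R : comNzRingType) (M : lmodType R) (r : R) (x y : M) :
  scale_set r [set: M] x -> scale_set r [set: M] y ->
  scale_set r [set: M] (x - y).
Proof. by move=> [u _ <-] [v _ <-]; exists (u - v) => //; rewrite scalerBr. Qed.

Lemma scale_setT_sum (R : comNzRingType) (M : lmodType R) (r : R) (n : nat)
    (y : 'I_n -> M) :
  (forall i, scale_set r [set: M] (y i)) ->
  scale_set r [set: M] (\sum_(i < n) y i).
Proof.
move=> Ky; have /choice[u yE] : forall i, exists u, r *: u = y i.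
  by move=> i; have [u _ <-] := Ky i; exists u.
by exists (\sum_i u i) => //; rewrite scaler_sumr; apply: eq_bigr.
Qed.

(** By commutativity [c (r u) = r (c u)], and [c u] is in [rM] as soon as [c]
    is in [(rM : M)]: the factor [r] can be pulled out of [(rM : M) rM]. *)
Lemma phi1_scale_set (R : comNzRingType) (M : lmodType R) (r : R) :
  phi1 (scale_set r [set: M]) `<=` scale_set r (scale_set r [set: M]).
Proof.
move=> _ [n [c [y [Kc Ky ->]]]].
have /choice[u yE] : forall i, exists u, r *: u = y i.
  by move=> i; have [u _ <-] := Ky i; exists u.
exists (\sum_(i < n) c i *: u i).
  by apply: scale_setT_sum => i; exact: Kc.
rewrite scaler_sumr; apply: eq_bigr => i _.
by rewrite -yE !scalerA mulrC.
Qed.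

Lemma internal_direct_sumD (G : choiceType) (V : zmodType) (A : set V)
    (S : G -> set V) (h : G) (x y : V) :
  internal_direct_sum A S -> S h x -> S h y -> S h (x + y).
Proof.
move=> [/(_ h) /GRing.zmod_closedD[_ SD] _ _] Sx Sy.
by apply/set_mem/SD; exact: mem_set.
Qed.

Theorem theorem2p8 (G : groupType) (R : comNzRingType) (Rg : G -> set R)
    (M : lmodType R) (Mg : G -> set M)
    (gradR : ring_grading Rg) (gradM : module_grading Rg Mg)
    (r : R) (g : G) (r_e : Rg 1%g r)
    (rMg_neq : scale_set r (Mg g) <> Mg g)
    (ann_sub : annihilated M r `<=` scale_set r [set: M]) :
  g_phi1_prime Rg Mg g (scale_set r [set: M]) <->
  g_prime Rg Mg g (scale_set r [set: M]).
Proof.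
set K := scale_set r [set: M].
split=> -[gradK K_neq primeK]; split=> // a x a_e x_g; last first.
  by move=> [Kax _]; exact: primeK.
move=> Kax.
have [ax_phi|] := pselect (phi1 K (a *: x)); last by move=> ?; exact: primeK.
have ar_e : Rg 1%g (a + r) by apply: internal_direct_sumD gradR.1 a_e r_e.
have [arx_phi|arx_nphi] := pselect (phi1 K ((a + r) *: x)).
  left; move/phi1_scale_set: ax_phi => [y Ky axE].
  move/phi1_scale_set: arx_phi => [z Kz arxE].
  have Kd : K ((z - y) - x).
    apply: ann_sub; rewrite /annihilated /= !scalerBr arxE axE.
    by rewrite scalerDl addrAC addrK subrr.
  rewrite -[x](subKr (z - y)).
  by apply: scale_setTB => //; apply: scale_setTB.
have Karx : K ((a + r) *: x).
  by have [u _ uE] := Kax; exists (u + x) => //; rewrite scalerDl scalerDr uE.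
have [Kx|Kar] := primeK _ _ ar_e x_g (conj Karx arx_nphi); [by left|right].
move=> m; rewrite -[a](addrK r) scalerBl.
by apply: scale_setTB; [exact: Kar | exists m].
Qed.
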